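(* Let $E\subseteq\mathbb{R}^d$ and let $s>0$. If $E$ has finite $s$-packing content, then the following hold at $\mathcal{H}^s$-a.e. $x\in E$: (1) $\mathrm{AppTan}_{\mathrm{AW}}(E,x,s)=\mathrm{Tan}_{\mathrm{AW}}(E,x)$; (2) if $T_x$ is a strong approximate $s$-tangent of $E$ at $x$, then $\mathrm{Tan}_{\mathrm{AW}}(E,x)=\{T_x\}$.
   Context: Hausdorff measure: $\mathcal{H}^s(A)=\lim_{\delta\to0}\inf\{\sum_i(\operatorname{diam}U_i)^s: A\subset\bigcup_iU_i,\ \operatorname{diam}U_i\le\delta\}$. A metric space $Y$ has finite $s$-packing content if there is $M\in(0,\infty)$ such that $\sum_ir(B_i)^s<M$ for every countable collection of mutually disjoint closed balls $B_i\subset Y$ (centered in $Y$) with radii $r(B_i)\le\operatorname{diam}Y$; subsets of $\mathbb{R}^d$ are regarded as metric spaces with the Euclidean metric. For nonempty sets $A,B$ in a metric space $Z$, $\mathrm{ex}(A,B)=\sup_{a\in A}\inf_{b\in B}d_Z(a,b)$, $\mathrm{ex}(\emptyset,B)=0$, and $\mathrm{D}^{z,r}[A,B]=r^{-1}\max\{\mathrm{ex}(A\cap B_Z(z,r),B),\mathrm{ex}(B\cap B_Z(z,r),A)\}$, with $B_Z(z,r)$ the closed ball; $B^d(x,r)$ is the closed ball in $\mathbb{R}^d$. Let $\mathfrak{C}(\mathbb{R}^d,\mathbf{0})$ be the collection of closed subsets of $\mathbb{R}^d$ containing the origin $\mathbf{0}$. For $x\in E$, $\mathrm{Tan}_{\mathrm{AW}}(E,x)$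 is the set of all $T\in\mathfrak{C}(\mathbb{R}^d,\mathbf{0})$ for which there is a sequence of positive numbers $r_i\to0$ with $\lim_i\mathrm{D}^{\mathbf{0},R}[r_i^{-1}(E-x),T]=0$ for every $R>0$ (for closed $E$ this is convergence in the Attouch-Wets topology). A set $T\in\mathfrak{C}(\mathbb{R}^d,\mathbf{0})$ is an approximate $s$-tangent of $E$ at $x\in E$ if there exist a sequence of positive numbers $r_i\to0$ and subsets $E_{x,r_i}\subset E$ with $x\in E_{x,r_i}$ such that for every $R>0$ $$\lim_{i\to\infty}\frac{\mathcal{H}^s(E\cap B^d(x,Rr_i)\setminus E_{x,r_i})}{(2Rr_i)^s}=0\quad\text{and}\quad\lim_{i\to\infty}\mathrm{D}^{\mathbf{0},R}[r_i^{-1}(E_{x,r_i}-x),T]=0.$$ If this holds for all sequences $r_i\to0$ of positive numbers, $T$ is a strong approximate $s$-tangent of $E$ at $x$. $\mathrm{AppTan}_{\mathrm{AW}}(E,x,s)$ denotes the set of all approximate $s$-tangents of $E$ at $x$. *)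

(* Defs.v *)
From HB Require Import structures.
From mathcomp Require Import all_boot all_order all_algebra.
From mathcomp Require Import all_classical all_reals all_analysis.
From mathcomp Require Import ring.

Set Implicit Arguments.
Unset Strict Implicit.
Unset Printing Implicit Defensive.

Import Order.TTheory GRing.Theory Num.Theory.
Import numFieldNormedType.Exports.

Local Open Scope classical_set_scope.
Local Open Scope ring_scope.

(* [euclidean R d] is R^d with its Euclidean metric; it is a separate alias
   because the library equips 'rV[R]_d itself with the sup norm. *)
Definition euclidean (R : realType) (d : nat) : Type := 'rV[R]_d.

HB.instance Definition _ (R : realType) (d : nat) :=
  GRing.Lmodule.on (euclidean R d).

Definition euclidean_norm (R : realType) (d : nat) (x : euclidean R d) : R :=
  Num.sqrt (\sum_(i < d) (x : 'rV[R]_d) ord0 i ^+ 2).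

Definition euclidean_dist (R : realType) (d : nat) (x y : euclidean R d) : R :=
  euclidean_norm (x - y).

Section euclidean_metric.
Context (R : realType) (d : nat).
Implicit Types x y z : euclidean R d.

Lemma sumsq_ge0 (u : 'I_d -> R) : 0 <= \sum_(i < d) u i ^+ 2.
Proof. by apply: sumr_ge0 => i _; exact: sqr_ge0. Qed.

Lemma sum_cauchy_schwarz (u v : 'I_d -> R) :
  (\sum_(i < d) u i * v i) ^+ 2 <=
  (\sum_(i < d) u i ^+ 2) * (\sum_(i < d) v i ^+ 2).
Proof.
set a := \sum_(i < d) u i ^+ 2; set b := \sum_(i < d) v i ^+ 2.
set c := \sum_(i < d) u i * v i.
have quad (s t : R) :
    0 <= s ^+ 2 * a + 2 * s * t * c + t ^+ 2 * b.
  rewrite /a /b /c !mulr_sumr -!big_split /=; apply: sumr_ge0 => i _.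
  rewrite (_ : _ + _ = (s * u i + t * v i) ^+ 2) ?sqr_ge0//.
  by rewrite sqrrD !exprMn; congr (_ + _ + _); rewrite mulr2n; ring.
have a0 : 0 <= a by exact: sumsq_ge0.
have [az|an] := eqVneq a 0.
  have u0 i : u i = 0.
    apply/eqP; rewrite -sqrf_eq0.
    have /eqP := az; rewrite psumr_eq0 => [|j _]; last exact: sqr_ge0.
    by move=> /allP/(_ i); rewrite mem_index_enum => /(_ isT).
  rewrite /c big1 ?expr0n /= ?az ?mul0r// => i _.
  by rewrite u0 mul0r.
have ap : 0 < a by rewrite lt_neqAle eq_sym an.
have := quad (- c) a.
have -> : (- c) ^+ 2 * a + 2 * - c * a * c + a ^+ 2 * b = a * (a * b - c ^+ 2).
  by ring.
by rewrite pmulr_rge0// subr_ge0.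
Qed.

Lemma euclidean_distxx x : euclidean_dist x x = 0.
Proof.
rewrite /euclidean_dist /euclidean_norm subrr big1 ?sqrtr0// => i _.
by rewrite mxE expr0n.
Qed.

Lemma euclidean_dist_positivity x y : euclidean_dist x y = 0 -> x = y.
Proof.
move=> /eqP; rewrite sqrtr_eq0 => s0.
have {s0} /eqP : \sum_(i < d) ((x - y) : 'rV[R]_d) ord0 i ^+ 2 = 0.
  by apply/eqP; rewrite eq_le s0 sumsq_ge0.
rewrite psumr_eq0 => [/allP s0|i _]; last exact: sqr_ge0.
apply/(@matrixP R) => i j; rewrite ord1.
have := s0 j; rewrite mem_index_enum => /(_ isT) /=.
by rewrite sqrf_eq0 !mxE subr_eq0 => /eqP.
Qed.

Lemma euclidean_dist_sym x y : euclidean_dist x y = euclidean_dist y x.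
Proof.
congr Num.sqrt; apply: eq_bigr => i _.
by rewrite !mxE -sqrrN opprB.
Qed.

Lemma euclidean_dist_triangle y x z :
  euclidean_dist x z <= euclidean_dist x y + euclidean_dist y z.
Proof.
rewrite /euclidean_dist /euclidean_norm.
set u := fun i => ((x - y) : 'rV[R]_d) ord0 i.
set v := fun i => ((y - z) : 'rV[R]_d) ord0 i.
rewrite (eq_bigr (fun i => (u i + v i) ^+ 2)); last first.
  by move=> i _; rewrite /u /v !mxE addrA subrK.
rewrite -/(\sum_(i < d) u i ^+ 2) -/(\sum_(i < d) v i ^+ 2).
set a := \sum_(i < d) u i ^+ 2; set b := \sum_(i < d) v i ^+ 2.
have a0 : 0 <= a by exact: sumsq_ge0.
have b0 : 0 <= b by exact: sumsq_ge0.
rewrite -(@ler_pXn2r _ 2)// ?nnegrE ?sqrtr_ge0 ?addr_ge0 ?sqrtr_ge0//.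
rewrite sqr_sqrtr; last exact: sumsq_ge0.
rewrite sqrrD !sqr_sqrtr// -sqrtrM//.
have -> : \sum_(i < d) (u i + v i) ^+ 2 =
          a + (\sum_(i < d) u i * v i) *+ 2 + b.
  rewrite /a /b -sumrMnl -!big_split /=.
  by apply: eq_bigr => i _; rewrite sqrrD.
rewrite lerD2r lerD2l lerMn2r /=.
apply: le_trans (ler_norm _) _.
by rewrite -sqrtr_sqr ler_sqrt ?mulr_ge0// sum_cauchy_schwarz.
Qed.

HB.instance Definition _ := @isMetric.Build R (euclidean R d)
  (@euclidean_dist R d) euclidean_distxx euclidean_dist_positivity
  euclidean_dist_sym euclidean_dist_triangle.

End euclidean_metric.

Section metric_notions.
Context (R : realType) (Z : metricType R).
Implicit Types (A B Y U : set Z) (z : Z) (r s : R).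

(* The library's [closed_ball] is the closure of the open ball, which may be
   smaller in a general metric space. *)
Definition metric_cball z r : set Z := [set y | mdist z y <= r].

(* Including 0 in the supremum only matters for [U = set0], of diameter 0. *)
Definition diam U : \bar R :=
  maxe 0%E
    (ereal_sup [set t | exists x y, [/\ U x, U y & t = (mdist x y)%:E]]).

(* Finite covers are padded with empty sets, which contribute 0 when 0 < s. *)
Definition hausdorff_content s (delta : R) A : \bar R :=
  ereal_inf [set t | exists U : nat -> set Z,
    [/\ A `<=` \bigcup_i U i,
        (forall i, diam (U i) <= delta%:E)%E
      & t = (\sum_(0 <= i <oo) poweR (diam (U i)) s)%E]].

Definition hausdorff_measure s A : \bar R :=
  lim (hausdorff_content s delta A @[delta --> (0 : R)^'+]).

(* [Y] is regarded as a metric space with the restricted metric, so its closed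
   balls are the traces on [Y] of balls centered in [Y], and two balls are
   disjoint when these traces are. Set-theoretically a ball need not determine
   its radius, hence a countable collection of balls is given by centers and
   radii, indexed by a set [I] of naturals. *)
Definition finite_packing_content s Y : Prop :=
  exists2 M : R, 0 < M &
    forall (I : set nat) (c : nat -> Z) (r : nat -> R),
      (forall i, I i -> [/\ Y (c i), 0 < r i & ((r i)%:E <= diam Y)%E]) ->
      trivIset I (fun i => Y `&` metric_cball (c i) (r i)) ->
      (\esum_(i in I) (r i `^ s)%:E < M%:E)%E.

(* Taking the maximum with 0 only matters for [A = set0]. *)
Definition excess A B : \bar R :=
  maxe 0%E (ereal_sup [set ereal_inf [set (mdist a b)%:E | b in B] | a in A]).

Definition walkup_dist z r A B : \bar R :=
  (r^-1%:E * maxe (excess (A `&` metric_cball z r) B)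
                  (excess (B `&` metric_cball z r) A))%E.

End metric_notions.

Section tangents.
Context (R : realType) (d : nat).
Local Notation V := (euclidean R d).
Implicit Types (E T : set V) (x : V) (r : nat -> R).

Definition closed_with_origin T : Prop := closed T /\ T 0.

Definition blowup E x (t : R) : set V := [set t^-1 *: (y - x : V) | y in E].

Definition pos_null_seq r : Prop :=
  (forall i, 0 < r i) /\ r i @[i --> \oo] --> (0 : R).

Definition AW_blowups_to (S : nat -> set V) x r T : Prop :=
  forall rho : R, 0 < rho ->
    walkup_dist (0 : V) rho (blowup (S i) x (r i)) T @[i --> \oo] --> 0%E.

Definition Tan_AW E x : set (set V) :=
  [set T | closed_with_origin T /\
    exists2 r, pos_null_seq r & AW_blowups_to (fun=> E) x r T].

Definition approx_tangent_along E x s T r : Prop :=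
  exists S : nat -> set V,
    [/\ (forall i, S i `<=` E /\ S i x),
        (forall rho : R, 0 < rho ->
           (hausdorff_measure s
              ((E `&` metric_cball x (rho * r i)) `\` S i)
            * (((2 * rho * r i) `^ s)^-1)%:E)%E @[i --> \oo] --> 0%E)
      & AW_blowups_to S x r T].

Definition approx_tangent E x s T : Prop :=
  closed_with_origin T /\
  exists2 r, pos_null_seq r & approx_tangent_along E x s T r.

Definition strong_approx_tangent E x s T : Prop :=
  closed_with_origin T /\
  forall r, pos_null_seq r -> approx_tangent_along E x s T r.

Definition AppTan_AW E x s : set (set V) := [set T | approx_tangent E x s T].

End tangents.

(* Main.v *)
(* For [H^s]-almost every [x] in [E], the sets [S i] of an approximate tangent
   can be replaced by [E] itself along the same scales.  Where they cannot,
   there are points [y] of [E] with [|x - y| <= m t] and [t] arbitrarily small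
   such that [E] has measure at most [eta t^s] in [B(y, t)]: since [S i] is close
   to the tangent, it misses that ball.  For fixed [m], let [A] be the set of
   those [x] for which this happens for every [eta > 0].  A greedy disjoint
   subfamily [B(y_k, t_k)] of these balls satisfies [sum_k t_k^s < M] by the
   packing hypothesis.  A point of [A] outside all the selected balls lies in
   infinitely many of the enlarged balls [B(y_k, (2m + 3) t_k)], so those points
   form a null set by summability, while [E] has measure at most [eta M] in the
   union of the selected balls.  Hence [H^s(A) <= eta M] for every [eta > 0]. *)

Require Import Defs.
From mathcomp Require Import all_boot all_order all_algebra.
From mathcomp Require Import all_classical all_reals all_analysis.
From mathcomp Require Import ring lra.
Set Implicit Arguments.
Unset Strict Implicit.
Unset Printing Implicit Defensive.
Import Order.TTheory GRing.Theory Num.Theory.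
Import numFieldNormedType.Exports.
Local Open Scope classical_set_scope.
Local Open Scope ring_scope.

Lemma cvge0P (R : realType) (f : nat -> \bar R) :
  (forall n, 0 <= f n)%E ->
  f n @[n --> \oo] --> 0%E <->
  forall e : R, 0 < e -> \forall n \near \oo, (f n < e%:E)%E.
Proof.
move=> f0; split=> [/fine_cvgP[ffin fcvg] e e0|flt].
  move/cvgrPdist_lt : fcvg => /(_ _ e0) fcvg.
  near=> n.
  have : `|0 - fine (f n)| < e by near: n.
  have fn : f n \is a fin_num by near: n.
  rewrite sub0r normrN ger0_norm; last exact: fine_ge0.
  by rewrite -lte_fin fineK.
have ffin : \forall n \near \oo, f n \is a fin_num.
  near=> n; rewrite ge0_fin_numE//.
  by rewrite (@lt_trans _ _ 1%:E) ?ltry//; near: n; exact: flt.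
apply/fine_cvgP; split=> //.
apply/cvgrPdist_lt => e e0; near=> n.
rewrite sub0r normrN ger0_norm; last exact: fine_ge0.
rewrite -lte_fin fineK; first by near: n; exact: flt.
by near: n.
Unshelve. all: by end_near. Qed.

(** * Hausdorff content and measure: monotonicity and countable subadditivity *)

Section hausdorff.
Context (R : realType) (Z : metricType R).
Implicit Types (A B U : set Z) (z : Z) (s delta : R).

Lemma diam_ge0 A : (0 <= diam A)%E.
Proof. by rewrite /diam le_max lexx. Qed.

Lemma diam_le A (t : R) : 0 <= t ->
  (forall x y, A x -> A y -> mdist x y <= t) -> (diam A <= t%:E)%E.
Proof.
move=> t0 At; rewrite /diam ge_max lee_fin t0/=.
by apply: ge_ereal_sup => _ [x [y [Ax Ay ->]]]; rewrite lee_fin At.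
Qed.

Lemma diam_set0 : diam (set0 : set Z) = 0%E.
Proof. by apply/eqP; rewrite eq_le diam_ge0 andbT; apply: diam_le. Qed.

Lemma diam_metric_cball z (t : R) : 0 <= t ->
  (diam (metric_cball z t) <= (2 * t)%:E)%E.
Proof.
move=> t0; apply: diam_le; first by rewrite mulr_ge0.
move=> x y zx zy; rewrite (le_trans (metric_triangle x z y))//.
by rewrite metric_sym mulr_natl mulr2n lerD.
Qed.

Lemma hausdorff_content_ge0 s delta A : (0 <= hausdorff_content s delta A)%E.
Proof.
apply: le_ereal_inf_tmp => _ [U [_ _ ->]].
by apply: nneseries_ge0 => n _ _; exact: poweR_ge0.
Qed.

Lemma le_hausdorff_content s delta A B : A `<=` B ->
  (hausdorff_content s delta A <= hausdorff_content s delta B)%E.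
Proof.
move=> AB; apply: ereal_inf_le_tmp => _ [U [BU Ud ->]].
by exists U; split=> //; exact: subset_trans BU.
Qed.

Lemma hausdorff_content_nincr s delta1 delta2 A : delta1 <= delta2 ->
  (hausdorff_content s delta2 A <= hausdorff_content s delta1 A)%E.
Proof.
move=> d12; apply: ereal_inf_le_tmp => _ [U [AU Ud ->]].
by exists U; split=> // i; rewrite (le_trans (Ud i))// lee_fin.
Qed.

(** Shrinking [delta] leaves fewer covers and so raises the content; the limit at [0^+] is therefore
    a supremum, and bounds on the measure reduce to bounds at each fixed scale. *)
Lemma hausdorff_measureE s A : hausdorff_measure s A =
  ereal_sup [set hausdorff_content s delta A | delta in [set x | 0 < x]].
Proof.
apply: cvg_lim => //.
have := @nonincreasing_at_right_cvge R (hausdorff_content s ^~ A) 0 +oo%O isT.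
rewrite (_ : [set` _] = [set x | 0 < x]); last first.
  by apply/seteqP; split=> x /=; rewrite in_itv/= andbT.
by apply => x y _ _ xy; exact: hausdorff_content_nincr.
Qed.

Lemma hausdorff_content_le_measure s delta A : 0 < delta ->
  (hausdorff_content s delta A <= hausdorff_measure s A)%E.
Proof.
by move=> d0; rewrite hausdorff_measureE; apply: ereal_sup_ubound; exists delta.
Qed.

Lemma hausdorff_measure_le s A (c : \bar R) :
  (forall delta, 0 < delta -> (hausdorff_content s delta A <= c)%E) ->
  (hausdorff_measure s A <= c)%E.
Proof.
move=> Ac; rewrite hausdorff_measureE.
by apply: ge_ereal_sup => _ [d d0 <-]; exact: Ac.
Qed.

Lemma hausdorff_measure_ge0 s A : (0 <= hausdorff_measure s A)%E.
Proof.
rewrite (le_trans _ (@hausdorff_content_le_measure s 1 A ltr01))//.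
exact: hausdorff_content_ge0.
Qed.

Lemma le_hausdorff_measure s A B : A `<=` B ->
  (hausdorff_measure s A <= hausdorff_measure s B)%E.
Proof.
move=> AB; apply: hausdorff_measure_le => d d0.
rewrite (le_trans (le_hausdorff_content _ _ AB))//.
exact: hausdorff_content_le_measure.
Qed.

(** Covers of the [A n] that are optimal up to [e / 2^(n+1)] are merged into one sequence through a
    bijection of [nat] with [nat * nat]. *)
Lemma hausdorff_content_bigcup s delta (A : nat -> set Z) :
  (hausdorff_content s delta (\bigcup_n A n) <=
   \sum_(0 <= n <oo) hausdorff_content s delta (A n))%E.
Proof.
have c0 n : (0 <= hausdorff_content s delta (A n))%E.
  exact: hausdorff_content_ge0.
(* Near-optimal covers exist only for finite contents; one infinite content makes the right-hand
   side infinite. *)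
have [[i ioo]|] := pselect (exists i, hausdorff_content s delta (A i) = +oo%E).
  rewrite (eseries_pinfty _ _ ioo) ?leey// => n _.
  by rewrite -ltNye (lt_le_trans _ (c0 _)).
move/forallNP => Aoo.
apply/lee_addgt0Pr => e e0.
apply: le_trans (epsilon_trick xpredT c0 (ltW e0)).
pose P n (U : nat -> set Z) := [/\ A n `<=` \bigcup_i U i,
    (forall i, diam (U i) <= delta%:E)%E
  & (\sum_(0 <= i <oo) poweR (diam (U i)) s <=
     hausdorff_content s delta (A n) + (e / (2 ^ n.+1)%:R)%:E)%E].
have [G PG] : {G : nat -> nat -> set Z & forall n, P n (G n)}.
  apply: (@choice _ _ P) => n.
  have en : 0 < e / (2 ^ n.+1)%:R by rewrite divr_gt0// ltr0n expn_gt0.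
  have fin : hausdorff_content s delta (A n) \is a fin_num.
    by rewrite ge0_fin_numE// ltey; apply/eqP; exact: Aoo.
  have [_ [U [AU Ud ->]] /ltW lt] := lb_ereal_inf_adherent en fin.
  by exists U; split.
have /card_esym/ppcard_eqP[f] := card_nat2.
apply: (@le_trans _ _
    (\sum_(0 <= n <oo) \sum_(0 <= i <oo) poweR (diam (G n i)) s)%E); last first.
  apply: lee_nneseries => [n _ _|n _]; last by have [] := PG n.
  by apply: nneseries_ge0 => *; exact: poweR_ge0.
have -> : (\sum_(0 <= n <oo) \sum_(0 <= i <oo) poweR (diam (G n i)) s =
    \sum_(0 <= k <oo) poweR (diam (G (f k).1 (f k).2)) s)%E.
  rewrite !nneseries_esumT; last 2 first.
  - by move=> *; exact: poweR_ge0.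
  - by move=> n; apply: nneseries_ge0 => *; exact: poweR_ge0.
  under eq_esum => n _ do
    [rewrite nneseries_esumT; last by move=> *; exact: poweR_ge0].
  rewrite esum_esum; last by move=> *; exact: poweR_ge0.
  rewrite (_ : _ `*`` _ = setT); last by apply/seteqP; split.
  by apply: reindex_esum; exact: bij.
apply: ereal_inf_lbound; exists (fun k => G (f k).1 (f k).2); split=> //.
- move=> x [n _ Anx]; have [/(_ _ Anx)[i _ Gx] _ _] := PG n.
  by exists (f^-1%FUN (n, i)) => //; rewrite invK ?inE.
- by move=> k; have [_ + _] := PG (f k).1; exact.
Qed.

Lemma hausdorff_content_cover s delta A (U : nat -> set Z) :
  A `<=` \bigcup_i U i -> (forall i, diam (U i) <= delta%:E)%E ->
  (hausdorff_content s delta A <= \sum_(0 <= i <oo) poweR (diam (U i)) s)%E.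
Proof. by move=> AU Ud; apply: ereal_inf_lbound; exists U. Qed.

Lemma hausdorff_content0 s delta : 0 < s -> 0 < delta ->
  hausdorff_content s delta (set0 : set Z) = 0%E.
Proof.
move=> s0 d0; apply/eqP; rewrite eq_le hausdorff_content_ge0 andbT.
rewrite (le_trans (@hausdorff_content_cover _ _ _ (fun=> set0) _ _))//.
  by move=> i; rewrite diam_set0 lee_fin ltW.
by rewrite eseries0// => i _ _; rewrite diam_set0 poweR0r// gt_eqF.
Qed.

Lemma hausdorff_content_setU s delta A B : 0 < s -> 0 < delta ->
  (hausdorff_content s delta (A `|` B) <=
   hausdorff_content s delta A + hausdorff_content s delta B)%E.
Proof.
move=> s0 d0; rewrite -bigcup2E (le_trans (hausdorff_content_bigcup _ _ _))//.
rewrite (nneseries_split 0 2) => [|k _]; last exact: hausdorff_content_ge0.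
rewrite !add0n big_nat_recr//= big_nat1.
rewrite /bigcup2/= eseries0 ?adde0// => -[|[|i]]//= _ _.
by rewrite hausdorff_content0.
Qed.

Lemma hausdorff_measure0 s : 0 < s -> hausdorff_measure s (set0 : set Z) = 0%E.
Proof.
move=> s0; apply/eqP; rewrite eq_le hausdorff_measure_ge0 andbT.
by apply: hausdorff_measure_le => d d0; rewrite hausdorff_content0.
Qed.

Lemma hausdorff_measure_bigcup s (A : nat -> set Z) :
  (hausdorff_measure s (\bigcup_n A n) <=
   \sum_(0 <= n <oo) hausdorff_measure s (A n))%E.
Proof.
apply: hausdorff_measure_le => d d0.
rewrite (le_trans (hausdorff_content_bigcup _ _ _))//.
apply: lee_nneseries => n *; first exact: hausdorff_content_ge0.
exact: hausdorff_content_le_measure.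
Qed.

(** [A] covers itself at every scale, at cost [0^s = 0]. This settles the degenerate case in which
    no positive radius is at most [diam E], so that the packing hypothesis says nothing. *)
Lemma diam0_hausdorff_measure s A : 0 < s -> (diam A <= 0)%E ->
  hausdorff_measure s A = 0%E.
Proof.
move=> s0 A0; have dA : diam A = 0%E.
  by apply/eqP; rewrite eq_le A0 diam_ge0.
have dU i : diam (if i == 0%N then A else set0) = 0%E.
  by case: ifP => _; rewrite // diam_set0.
apply/eqP; rewrite eq_le hausdorff_measure_ge0 andbT.
apply: hausdorff_measure_le => d d0.
rewrite (le_trans (@hausdorff_content_cover _ _ _
  (fun i => if i == 0%N then A else set0) _ _))//.
- by move=> x Ax; exists 0%N.
- by move=> i; rewrite dU lee_fin ltW.
- by rewrite eseries0// => i _ _; rewrite dU poweR0r// gt_eqF.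
Qed.

End hausdorff.

(** * Greedy packing and the null set of starved points *)

Section packing.
Context (R : realType) (Z : metricType R).
Implicit Types (A E : set Z) (x y : Z) (s delta : R).

(* Greedy selection: at each step a ball of at least half the largest admissible
   radius is chosen; the packing bound makes every candidate eventually
   inadmissible. *)
Lemma greedy_packing s (E : set Z) (F : set (Z * R)) : 0 < s ->
    finite_packing_content s E ->
    (forall p, F p -> [/\ E p.1, 0 < p.2, p.2 <= 1 & (p.2%:E <= diam E)%E]) ->
    F !=set0 ->
  exists (I : set nat) (c : nat -> Z) (r : nat -> R),
    [/\ forall i, I i -> F (c i, r i),
        trivIset I (fun i => E `&` metric_cball (c i) (r i))
      & forall p, F p -> exists i, [/\ I i, p.2 <= 2 * r i &
          (E `&` metric_cball p.1 p.2 `&`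
           (E `&` metric_cball (c i) (r i))) !=set0]].
Proof.
move=> s0 [M M0 packM] HF [p0 Fp0].
pose trace (p : Z * R) := E `&` metric_cball p.1 p.2.
(* The candidates still admissible once the balls in [l] are chosen; disjointness concerns traces on
   [E], as in the packing hypothesis. *)
pose free (l : seq (Z * R)) p :=
  F p /\ forall q, q \in l -> trace p `&` trace q = set0.
pose choice_spec l (o : option (Z * R)) := if o is Some p
  then free l p /\ forall q, free l q -> q.2 <= 2 * p.2
  else forall q, ~ free l q.
have [pick_next nextP] : {pick_next : seq (Z * R) -> option (Z * R) &
    forall l, choice_spec l (pick_next l)}.
  apply: (@choice _ _ choice_spec) => l.
  have [[q fq]|/forallNP nofree] := pselect (exists q, free l q); last first.
    by exists None.
  pose radii := [set p.2 | p in free l].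
  have sup_radii : has_sup radii.
    split; first by exists q.2, q.
    by exists 1 => _ [p [/HF[_ _ p1 _] _] <-].
  have q0 : 0 < q.2 by have [/HF[]] := fq.
  have sup_gt0 : 0 < sup radii.
    by apply: lt_le_trans q0 _; apply: ub_le_sup; [exact: sup_radii.2|exists q].
  (* The supremum of the admissible radii need not be attained, but it is positive and finite, so
     some radius exceeds half of it. *)
  have [|_ [p fp <-] psup] := @sup_adherent _ radii (sup radii / 2) _ sup_radii.
    by rewrite divr_gt0.
  exists (Some p); split=> // q' fq'.
  have : q'.2 <= sup radii by apply: ub_le_sup; [exact: sup_radii.2|exists q'].
  lra.
(* [L k] lists the balls chosen before round [k]. A round without admissible candidates leaves the
   list unchanged and its index stays out of [I], where the default [p0] in [sel] is harmless. *)
pose L k := iter k (fun l => if pick_next l is Some p then p :: l else l) [::].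
pose I := [set k | isSome (pick_next (L k))].
pose sel k := odflt p0 (pick_next (L k)).
have LE k : L k.+1 = if pick_next (L k) is Some p then p :: L k else L k.
  by [].
have LS k : I k -> L k.+1 = sel k :: L k.
  by rewrite LE /I /sel /=; case: (pick_next _).
have freeI k : I k -> free (L k) (sel k) /\
    forall q, free (L k) q -> q.2 <= 2 * (sel k).2.
  by move: (nextP (L k)); rewrite /I /sel /=; case: (pick_next _).
have sel_mem j k : I j -> (j < k)%N -> sel j \in L k.
  move=> Ij; elim: k => // k IHk; rewrite ltnS leq_eqVlt.
  move=> /orP[/eqP <-|/IHk mem].
    by rewrite LS// mem_head.
  by rewrite LE; case: (pick_next _) => // p; rewrite in_cons mem orbT.
have disj : trivIset I (fun i => trace (sel i)).
  apply/trivIsetP => i j Ii Ij.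
  wlog ij : i j Ii Ij / (i < j)%N => [wlg|].
    rewrite neq_ltn => /orP[ij|ji]; first by apply: wlg; rewrite ?ltn_eqF.
    by rewrite setIC; apply: wlg; rewrite ?ltn_eqF.
  move=> _; have [[_ /(_ (sel i) (sel_mem _ _ Ii ij)) ji0] _] := freeI _ Ij.
  by rewrite setIC.
exists I, (fun k => (sel k).1), (fun k => (sel k).2); split=> //.
  by move=> i /freeI[[Fi _] _]; rewrite -surjective_pairing.
move=> p Fp.
(* If [p] stayed admissible forever, every round would select a radius at least [p.2 / 2], and
   finitely many of these already exceed the packing bound [M]. *)
have [k nfree] : exists k, ~ free (L k) p.
  apply: contrapT => /forallNP/= allfree.
  have {}allfree k : free (L k) p by exact: contrapT (allfree k).
  have allI k : I k.
    have := nextP (L k); rewrite /I /=; case: (pick_next _) => //.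
    by move=> /(_ p)/(_ (allfree k)).
  have p20 : 0 < p.2 by have [] := HF _ Fp.
  have rk k : p.2 / 2 <= (sel k).2.
    by have [_ /(_ p (allfree k))] := freeI _ (allI k); lra.
  have : (\esum_(i in I) ((sel i).2 `^ s)%:E < M%:E)%E.
    apply: (packM I (fun k => (sel k).1)) disj => i /freeI[[+ _] _].
    by move=> /HF[].
  have -> : I = setT by apply/seteqP; split.
  rewrite -nneseries_esumT; last by move=> n; rewrite lee_fin powR_ge0.
  have a0 : 0 < (p.2 / 2) `^ s by rewrite powR_gt0// divr_gt0.
  pose n := (Num.truncn (M / (p.2 / 2) `^ s)).+1.
  apply/negP; rewrite -leNgt.
  apply: le_trans (@nneseries_lim_ge _ _ _ _ n _); last first.
    by move=> i _ _; rewrite lee_fin powR_ge0.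
  rewrite sumEFin lee_fin.
  apply: (@le_trans _ _ (\sum_(0 <= i < n) (p.2 / 2) `^ s)).
    rewrite sumr_const_nat subn0 -[leRHS]mulr_natl -ler_pdivrMr// ltW//.
    exact: truncnS_gt.
  apply: ler_sum => i _; apply: ge0_ler_powR; [exact: ltW| | |exact: rk].
    by rewrite nnegrE divr_ge0// ltW.
  by rewrite nnegrE (le_trans _ (rk i))// divr_ge0// ltW.
(* The induction locates the round at which [p] stops being admissible. It was admissible just
   before, which bounds its radius by twice the selected one, and the ball just added is the only
   one it can meet. *)
elim: k nfree => [|k IHk] nfree.
  by exfalso; apply: nfree; split.
have [freek|/IHk//] := pselect (free (L k) p).
have [Ik|nIk] := pselect (I k); last first.
  exfalso; apply: nfree; move: nIk; rewrite LE /I /=.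
  by case: (pick_next _).
exists k; split=> //; first by have [_] := freeI _ Ik; exact.
apply: contrapT => meet0; apply: nfree; split=> // q.
rewrite LS// in_cons => /orP[/eqP ->|]; last exact: freek.2.
by apply: contrapT => /eqP/set0P; exact: meet0.
Qed.

(* The set [A] of the opening comment. *)
Definition starved s E (m : R) : set Z := [set x | E x /\
  forall eta delta, 0 < eta -> 0 < delta -> exists y t,
    [/\ E y, 0 < t <= delta, mdist x y <= m * t &
        (hausdorff_measure s (E `&` metric_cball y t) <= (eta * t `^ s)%:E)%E]].

(** For every [N] the enlarged balls of index at least [N] cover [A], at a cost bounded by [(2K)^s]
    times a tail of a convergent series. *)
Lemma hausdorff_content_borel_cantelli s (I : set nat) (c : nat -> Z)
    (r : nat -> R) (K delta : R) A : 0 < s -> 0 < delta -> 0 <= K ->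
    (forall i, I i -> 0 <= r i /\ 2 * (K * r i) <= delta) ->
    (\esum_(i in I) (r i `^ s)%:E < +oo)%E ->
    (forall N x, A x ->
      exists i, [/\ I i, (N <= i)%N & mdist (c i) x <= K * r i]) ->
  hausdorff_content s delta A = 0%E.
Proof.
move=> s0 d0 K0 Ir sumfin Acov.
apply/eqP; rewrite eq_le hausdorff_content_ge0 andbT.
pose b i : \bar R := if i \in I then (r i `^ s)%:E else 0%E.
have b0 i : (0 <= b i)%E by rewrite /b; case: ifP; rewrite // lee_fin powR_ge0.
have sumb : (\sum_(0 <= i <oo) b i < +oo)%E.
  by rewrite nneseries_esumT// /b -esum_mkcond.
have tail0 : (((2 * K) `^ s)%:E * \sum_(N <= i <oo) b i)%E @[N --> \oo] --> 0%E.
  rewrite -[X in _ --> X](mule0 ((2 * K) `^ s)%:E).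
  by apply: cvgeZl => //; exact: nneseries_tail_cvg.
apply: (cvge_to_ge tail0); apply: nearW => N.
pose V i := if (i + N)%N \in I
  then metric_cball (c (i + N)%N) (K * r (i + N)%N) else set0.
have dV i : (diam (V i) <=
    (if (i + N)%N \in I then 2 * (K * r (i + N)%N) else 0)%:E)%E.
  rewrite /V; case: ifPn => [/set_mem/Ir[r0 _]|_]; last by rewrite diam_set0.
  by rewrite diam_metric_cball// mulr_ge0.
rewrite (le_trans (@hausdorff_content_cover _ _ _ _ _ V _ _))//.
- move=> x /(Acov N)[i [Ii Ni xi]]; exists (i - N)%N => //.
  by rewrite /V subnK// mem_set.
- move=> i; rewrite (le_trans (dV i))// lee_fin.
  by case: ifPn => [/set_mem/Ir[_]//|_]; exact: ltW.
rewrite -nneseriesZl// -[leRHS]nneseries_addn; last first.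
  by move=> i; apply: mule_ge0; rewrite ?lee_fin ?powR_ge0.
apply: lee_nneseries => i *; first exact: poweR_ge0.
have := dV i; rewrite /b; case: ifPn => [/set_mem/Ir[r0 _] di|_ di].
  rewrite -EFinM -powRM// ?mulr_ge0// -mulrA -poweR_EFin.
  apply: gt0_ler_poweR => //; first exact: ltW.
    by rewrite in_itv/= diam_ge0 leey.
  by rewrite in_itv/= lee_fin leey andbT !mulr_ge0.
have -> : diam (V i) = 0%E by apply/eqP; rewrite eq_le di diam_ge0.
by rewrite mule0 poweR0r// gt_eqF.
Qed.

Lemma starved_null s E (m : R) : 0 < s -> 0 <= m ->
    finite_packing_content s E ->
  hausdorff_measure s (starved s E m) = 0%E.
Proof.
move=> s0 m0 packE.
have subE : starved s E m `<=` E by move=> x [].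
have [diam0|diamE] := leP (diam E) 0%E.
  apply/eqP; rewrite eq_le hausdorff_measure_ge0 andbT.
  by rewrite -(diam0_hausdorff_measure s0 diam0) le_hausdorff_measure.
have [tau0 tau00 tau0E] : exists2 tau0 : R, 0 < tau0 & (tau0%:E <= diam E)%E.
  case: (diam E) diamE => [r r0||//]; first by exists r.
  by exists 1; rewrite ?leey.
have [M M0 packM] := packE.
apply/eqP; rewrite eq_le hausdorff_measure_ge0 andbT.
apply/lee_addgt0Pr => e e0; rewrite add0e.
apply: hausdorff_measure_le => delta d0.
pose eta := e / M.
have eta0 : 0 < eta by rewrite divr_gt0.
(* If a candidate of radius [u <= 2 r_i] centered within [m u] of [x] meets the ball [i], then [x]
   is within [m u + u + r_i <= (2m + 3) r_i] of [c i]. *)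
pose K := 2 * m + 3.
have K0 : 0 < K by rewrite /K; lra.
(* The first two caps make the balls admissible for the greedy selection and the packing bound; the
   third keeps the diameters of the balls enlarged by [K] below [delta]. *)
pose tau := Num.min (Num.min 1 tau0) (delta / (2 * K)).
have tau_gt0 : 0 < tau by rewrite !lt_min ltr01 tau00 divr_gt0// mulr_gt0.
pose F := [set p : Z * R | [/\ E p.1, 0 < p.2 <= tau &
  (hausdorff_measure s (E `&` metric_cball p.1 p.2) <= (eta * p.2 `^ s)%:E)%E]].
have FA x t : starved s E m x -> 0 < t ->
    exists2 p, F p & mdist x p.1 <= m * p.2 /\ p.2 <= t.
  move=> [Ex /(_ eta (Num.min tau t) eta0)] sx t0.
  have [|y [u [Ey /andP[u0]]]] := sx; first by rewrite lt_min tau_gt0.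
  rewrite le_min => /andP[utau ut] xy Hy.
  by exists (y, u); split=> //=; rewrite u0.
have [A0|/set0P[x0 Ax0]] := eqVneq (starved s E m) set0.
  by rewrite A0 hausdorff_content0// lee_fin ltW.
have [p1 Fp1 _] := FA _ _ Ax0 ltr01.
have [|I [c [r [IF disj meetF]]]] :=
    @greedy_packing s E F s0 packE _ (ex_intro _ p1 Fp1).
  move=> p [Ep /andP[p0 ptau] _]; move: ptau; rewrite !le_min.
  move=> /andP[/andP[p_1 ptau0] _].
  by split=> //; rewrite (le_trans _ tau0E)// lee_fin.
have sumM : (\esum_(i in I) (r i `^ s)%:E < M%:E)%E.
  apply: packM disj => i /IF[/= Ei /andP[ri0 ritau] _]; split=> //.
  rewrite (le_trans _ tau0E)// lee_fin (le_trans ritau)// !ge_min.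
  by rewrite lexx orbT.
pose B i := if i \in I then E `&` metric_cball (c i) (r i) else set0.
pose A' := starved s E m `\` \bigcup_i B i.
have A'0 : hausdorff_content s delta A' = 0%E.
  apply: (@hausdorff_content_borel_cantelli s I c r K) => //; first exact: ltW.
  - move=> i /IF[_ /andP[/= ri0 ritau] _]; split; first exact: ltW.
    have : r i <= delta / (2 * K).
      by rewrite (le_trans ritau)// !ge_min lexx orbT.
    by rewrite ler_pdivlMr ?mulr_gt0// => h; rewrite mulrA mulrC.
  - by rewrite (lt_trans sumM)// ltry.
  - move=> N x [Ax notB].
    (* A candidate of radius at most [t] supplied at [x] lies within [(m + 1) t] of [x], so it
       misses the selected balls of index below [N]. The selected ball that it does meet then has
       index at least [N]. *)
    have [t t0 farx] : exists2 t, 0 < t & forall i, (i < N)%N -> I i ->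
        r i + (m + 1) * t < mdist x (c i).
      elim: N => [|N [t t0 IHN]]; first by exists 1.
      have [IN|nIN] := pselect (I N); last first.
        exists t => // i; rewrite ltnS leq_eqVlt => /orP[/eqP ->//|].
        exact: IHN.
      have gap : r N < mdist x (c N).
        rewrite ltNge; apply/negP => xN; apply: notB; exists N => //.
        rewrite /B mem_set//; split; first exact: subE.
        by rewrite /metric_cball/= metric_sym.
      (* Then [(m + 1) u] is half the gap between [x] and the ball [N], which keeps the inequality
         strict. *)
      pose u := (mdist x (c N) - r N) / (2 * (m + 1)).
      have u0 : 0 < u by rewrite divr_gt0 ?subr_gt0//; lra.
      have ueq : (m + 1) * u = (mdist x (c N) - r N) / 2.
        by rewrite /u; field; lra.
      exists (Num.min t u); first by rewrite lt_min t0.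
      move=> i; rewrite ltnS leq_eqVlt => /orP[/eqP -> _|iN Ii].
        have : (m + 1) * Num.min t u <= (m + 1) * u.
          by rewrite ler_pM2l ?ge_min ?lexx ?orbT//; lra.
        lra.
      have := IHN _ iN Ii.
      have : (m + 1) * Num.min t u <= (m + 1) * t.
        by rewrite ler_pM2l ?ge_min ?lexx ?orbT//; lra.
      lra.
    have [p Fp [xp pt]] := FA _ _ Ax t0.
    have [i [Ii pi [w [[_ wp] [_ wi]]]]] := meetF _ Fp.
    have xci : mdist x (c i) <= m * p.2 + p.2 + r i.
      have := metric_triangle x p.1 (c i); have := metric_triangle p.1 w (c i).
      rewrite (metric_sym w); rewrite /metric_cball/= in wp wi.
      move: wp wi xp; lra.
    exists i; split=> //.
      rewrite leqNgt; apply/negP => iN; have := farx _ iN Ii.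
      have : (m + 1) * p.2 <= (m + 1) * t by rewrite ler_pM2l//; lra.
      by move: xci; lra.
    rewrite metric_sym (le_trans xci)// /K.
    have : m * p.2 <= m * (2 * r i) by rewrite ler_wpM2l.
    by move: pi; lra.
have -> : e%:E = (eta%:E * M%:E)%E by rewrite -EFinM /eta divfK// gt_eqF.
(* The part [A'] costs nothing, and each [B i] costs at most [eta] times [r_i^s], hence at most
   [eta M = e] in total. *)
have AB : starved s E m `<=` A' `|` \bigcup_i B i.
  by move=> x Ax; have [Bx|nBx] := pselect ((\bigcup_i B i) x); [right|left].
rewrite (le_trans (le_hausdorff_content _ _ AB))//.
rewrite (le_trans (hausdorff_content_setU _ _ _ _))// A'0 add0e.
rewrite (le_trans (hausdorff_content_bigcup _ _ _))//.
apply: (@le_trans _ _ (eta%:E * \esum_(i in I) (r i `^ s)%:E)%E); last first.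
  by rewrite lee_pmul2l ?lte_fin// ltW.
rewrite esum_mkcond -nneseries_esumT; last first.
  by move=> i; case: ifP => // _; rewrite lee_fin powR_ge0.
rewrite -nneseriesZl; last first.
  by move=> i _; case: ifP => // _; rewrite lee_fin powR_ge0.
apply: lee_nneseries => i *; first exact: hausdorff_content_ge0.
rewrite (le_trans (hausdorff_content_le_measure _ _ d0))// /B.
case: ifPn => [/set_mem/IF[_ _]//|_]; by rewrite mule0 hausdorff_measure0.
Qed.

Lemma hausdorff_measure_starved s E : 0 < s -> finite_packing_content s E ->
  hausdorff_measure s (\bigcup_(n : nat) starved s E n%:R) = 0%E.
Proof.
move=> s0 packE; apply/eqP; rewrite eq_le hausdorff_measure_ge0 andbT.
rewrite (le_trans (hausdorff_measure_bigcup _ _))// eseries0// => n _ _.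
exact: starved_null.
Qed.

End packing.

(** * Attouch-Wets convergence in pointwise form *)

Section excess.
Context (R : realType) (Z : metricType R).
Implicit Types (A B : set Z) (z : Z) (e rho : R).

Lemma excess_ge0 A B : (0 <= excess A B)%E.
Proof. by rewrite /excess le_max lexx. Qed.

Lemma excess_le A B e : 0 <= e ->
  (forall a, A a -> exists2 b, B b & mdist a b <= e) -> (excess A B <= e%:E)%E.
Proof.
move=> e0 AB; rewrite /excess ge_max lee_fin e0/=.
apply: ge_ereal_sup => _ [a Aa <-]; have [b Bb ab] := AB _ Aa.
by apply: ge_ereal_inf; exists (mdist a b)%:E; [exists b|rewrite lee_fin].
Qed.

Lemma excess_lt A B e a : (excess A B < e%:E)%E -> A a ->
  exists2 b, B b & mdist a b < e.
Proof.
rewrite /excess gt_max => /andP[_ supe] Aa.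
have /ereal_inf_lt[_ [b Bb <-]] :
    (ereal_inf [set (mdist a b)%:E | b in B] < e%:E)%E.
  by apply: le_lt_trans supe; apply: ereal_sup_ubound; exists a.
by rewrite lte_fin => ab; exists b.
Qed.

Definition locally_within z rho e A B :=
  forall a, A a -> mdist z a <= rho -> exists2 b, B b & mdist a b < e.

Lemma walkup_dist_ge0 z rho A B : 0 < rho -> (0 <= walkup_dist z rho A B)%E.
Proof.
move=> rho0; apply: mule_ge0; first by rewrite lee_fin invr_ge0 ltW.
by rewrite le_max excess_ge0.
Qed.

(** For fixed [rho] the factor [rho^-1] is absorbed into the arbitrary [e], which leaves pointwise
    closeness in both directions. *)
Lemma walkup_dist_cvg0P z (A : nat -> set Z) B :
  (forall rho, 0 < rho -> walkup_dist z rho (A i) B @[i --> \oo] --> 0%E) <->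
  (forall rho e, 0 < rho -> 0 < e -> \forall i \near \oo,
     locally_within z rho e (A i) B /\ locally_within z rho e B (A i)).
Proof.
split=> [cv rho e rho0 e0|near_within rho rho0].
  have /cvge0P lt := cv rho rho0.
  have := lt (fun i => walkup_dist_ge0 z (A i) B rho0) (rho^-1 * e).
  rewrite mulr_gt0 ?invr_gt0// => /(_ isT); apply: filterS => i.
  rewrite /walkup_dist EFinM lte_pmul2l ?lte_fin ?invr_gt0//.
  rewrite gt_max => /andP[AB BA].
  by split=> a Xa za; [apply: (excess_lt AB)|apply: (excess_lt BA)].
apply/cvge0P => [i|e e0]; first exact: walkup_dist_ge0.
(* Strict pointwise bounds give only a weak bound on the supremum, hence the half. *)
have re0 : 0 < rho * (e / 2) by rewrite mulr_gt0// divr_gt0.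
have := near_within _ _ rho0 re0; apply: filterS => i [AB BA].
rewrite /walkup_dist (@le_lt_trans _ _ (e / 2)%:E)//; last first.
  by rewrite lte_fin; lra.
rewrite (_ : (e / 2)%:E = (rho^-1%:E * (rho * (e / 2))%:E)%E); last first.
  by rewrite -EFinM mulKf// gt_eqF.
rewrite lee_pmul2l ?lte_fin ?invr_gt0// ge_max.
apply/andP; split; apply: excess_le => [|a [Xa za]]; rewrite ?ltW//.
  by have [b Bb /ltW ab] := AB _ Xa za; exists b.
by have [b Bb /ltW ab] := BA _ Xa za; exists b.
Qed.

End excess.

(** * Blow-ups and the passage from [S i] to [E] *)

Section tangents.
Context (R : realType) (d : nat).
Local Notation V := (euclidean R d).
Implicit Types (E T : set V) (x y : V) (r : nat -> R).

Lemma euclidean_normZ (k : R) (u : V) :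
  euclidean_norm (k *: u) = `|k| * euclidean_norm u.
Proof.
rewrite /euclidean_norm -sqrtr_sqr -sqrtrM ?sqr_ge0// mulr_sumr.
by congr Num.sqrt; apply: eq_bigr => i _; rewrite mxE exprMn.
Qed.

Lemma mdist_rescale x y z (t : R) : 0 < t ->
  mdist (t^-1 *: (y - x) : V) (t^-1 *: (z - x)) = t^-1 * mdist y z.
Proof.
move=> t0; rewrite /mdist/= /euclidean_dist -scalerBr euclidean_normZ.
rewrite ger0_norm ?invr_ge0 ?ltW//; congr (_ * euclidean_norm _).
by rewrite opprB addrA subrK.
Qed.

Lemma mdist0_rescale x y (t : R) : 0 < t ->
  mdist (0 : V) (t^-1 *: (y - x)) = t^-1 * mdist x y.
Proof. by move=> t0; rewrite -(mdist_rescale x x y t0) subrr scaler0. Qed.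

Lemma AW_blowups_toP (S : nat -> set V) x r T : AW_blowups_to S x r T <->
  (forall rho e : R, 0 < rho -> 0 < e -> \forall i \near \oo,
     locally_within (0 : V) rho e (blowup (S i) x (r i)) T /\
     locally_within (0 : V) rho e T (blowup (S i) x (r i))).
Proof. exact: walkup_dist_cvg0P. Qed.

(** A point of [T1] is close to a blow-up point, which is close to a point of [T2]; closedness of
    [T2] concludes. *)
Lemma AW_blowups_to_unique (S : nat -> set V) x r T1 T2 : closed T2 ->
  AW_blowups_to S x r T1 -> AW_blowups_to S x r T2 -> T1 `<=` T2.
Proof.
move=> clT2 /AW_blowups_toP lim1 /AW_blowups_toP lim2 a T1a.
rewrite ((closure_id T2).1 clT2) => U /nbhs_ballP[e /= e0 aeU].
have rho0 : 0 < mdist (0 : V) a + 1 by rewrite ltr_wpDl// mdist_ge0.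
pose rho := mdist (0 : V) a + 1.
(* The half leaves room for two hops; the cap 1 keeps the intermediate point inside the ball of
   radius [rho]. *)
pose e' := Num.min (e / 2) 1.
have e'0 : 0 < e' by rewrite lt_min ltr01 divr_gt0.
near \oo => i.
have [_ T1S] : locally_within (0 : V) rho e' (blowup (S i) x (r i)) T1 /\
    locally_within (0 : V) rho e' T1 (blowup (S i) x (r i)).
  by near: i; exact: lim1.
have [ST2 _] : locally_within (0 : V) rho e' (blowup (S i) x (r i)) T2 /\
    locally_within (0 : V) rho e' T2 (blowup (S i) x (r i)).
  by near: i; exact: lim2.
have [|b Sb ab] := T1S _ T1a; first by rewrite lerDl.
have [e'e e'1] : e' <= e / 2 /\ e' <= 1 by rewrite /e' !ge_min !lexx orbT.
have [|c T2c bc] := ST2 _ Sb.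
  by rewrite (le_trans (metric_triangle _ a _))// lerD2l (le_trans (ltW ab)).
exists c; split=> //; apply: aeU; rewrite ballEmdist /=.
by have := metric_triangle a b c; lra.
Unshelve. all: by end_near. Qed.

(** That [T] is close to [E] follows from [S i] being a subset of [E]. Conversely, a blow-up point
    of [E] far from [T] would be the center of a ball missing [S i]; the density condition makes [E]
    too thin there for a point that is not starved. *)
Lemma approx_tangent_along_blowups E x s T r : 0 < s ->
    (forall n : nat, ~ starved s E n%:R x) -> E x -> pos_null_seq r ->
  approx_tangent_along E x s T r -> AW_blowups_to (fun=> E) x r T.
Proof.
move=> s0 nstarved Ex [r0 rcvg] [S [SE HS /AW_blowups_toP limS]].
apply/AW_blowups_toP => rho e rho0 e0.
pose e1 := Num.min e 1.
have e10 : 0 < e1 by rewrite lt_min e0 ltr01.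
have [e1e e11] : e1 <= e /\ e1 <= 1 by rewrite /e1 !ge_min !lexx orbT.
have rho10 : 0 < rho + 1 by lra.
pose h := e1 / 2.
have h0 : 0 < h by rewrite divr_gt0.
(* The starvation parameter: a point of [E] within [rho * r i] of [x] is within [n] times the radius
   [h * r i]. *)
pose n := (Num.truncn (rho / h)).+1.
have nh : rho <= n%:R * h by rewrite -ler_pdivrMr// ltW// truncnS_gt.
have [eta [delta [eta0 d0 fed]]] : exists eta delta, [/\ 0 < eta, 0 < delta &
    forall y t, ~ [/\ E y, 0 < t <= delta, mdist x y <= n%:R * t &
      (hausdorff_measure s (E `&` metric_cball y t) <= (eta * t `^ s)%:E)%E]].
  apply: contrapT => noeta; apply: (nstarved n); split=> // eta delta eta0 d0.
  apply: contrapT => noyt; apply: noeta; exists eta, delta; split=> // y t yt.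
  by apply: noyt; exists y, t.
have pow0 : 0 < (2 * (rho + 1)) `^ s by rewrite powR_gt0// mulr_gt0.
(* Calibrated so that [zeta] times the [s]-th power of [2 * (rho + 1) * r i] is [eta] times that of
   [h * r i], the threshold excluded by [fed]. *)
pose zeta := eta * h `^ s / (2 * (rho + 1)) `^ s.
have zeta0 : 0 < zeta by rewrite divr_gt0// mulr_gt0// powR_gt0.
have /cvge0P Hlt := HS _ rho10.
near=> i.
have ri0 : 0 < r i by exact: r0.
have [ST TS] : locally_within (0 : V) (rho + 1) h (blowup (S i) x (r i)) T /\
    locally_within (0 : V) (rho + 1) h T (blowup (S i) x (r i)).
  by near: i; exact: limS.
split; last first.
  move=> a Ta a_rho; have [|_ [y Sy <-] ay] := TS _ Ta; first by lra.
  exists ((r i)^-1 *: (y - x)); first by exists y => //; exact: (SE i).1.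
  by rewrite (lt_le_trans ay)// /h; lra.
move=> _ [y Ey <-]; rewrite mdist0_rescale// => y_rho.
apply: contrapT => noT; apply: (fed y (h * r i)).
have xy : mdist x y <= rho * r i by rewrite mulrC -ler_pdivrMl// mulrC.
split=> //.
- rewrite mulr_gt0//=.
  have : r i < delta / h.
    near: i; move/cvgrPdist_lt : rcvg => /(_ (delta / h)).
    rewrite divr_gt0// => /(_ isT); apply: filterS => i.
    by rewrite sub0r normrN gtr0_norm.
  by rewrite ltr_pdivlMr// mulrC => /ltW.
- by rewrite (le_trans xy)// mulrA ler_wpM2r// ltW.
(* A point of [S i] in this ball would have a point of [T] within [h] after rescaling, placing [T]
   within [2h <= e] of the blow-up of [y]. *)
have sub : E `&` metric_cball y (h * r i) `<=`
    (E `&` metric_cball x ((rho + 1) * r i)) `\` S i.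
  move=> z [Ez yz]; rewrite /metric_cball/= in yz.
  have xz : mdist x z <= (rho + 1) * r i.
    rewrite (le_trans (metric_triangle x y z))// mulrDl lerD//.
    by rewrite (le_trans yz)// ler_wpM2r// ?ltW// /h; lra.
  split=> // Sz; apply: noT.
  have [||b Tb zb] := ST ((r i)^-1 *: (z - x)); first by exists z.
    by rewrite mdist0_rescale// ler_pdivrMl// mulrC.
  exists b => //.
  rewrite (le_lt_trans (metric_triangle _ ((r i)^-1 *: (z - x)) _))//.
  rewrite mdist_rescale//.
  have : (r i)^-1 * mdist y z <= h by rewrite ler_pdivrMl// mulrC.
  by move: zb e1e; rewrite /h; lra.
rewrite (le_trans (le_hausdorff_measure _ sub))//.
have : (hausdorff_measure s (E `&` metric_cball x ((rho + 1) * r i) `\` S i) *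
    (((2 * (rho + 1) * r i) `^ s)^-1)%:E < zeta%:E)%E.
  near: i; apply: Hlt => // i.
  by rewrite mule_ge0 ?hausdorff_measure_ge0// lee_fin invr_ge0 powR_ge0.
have p2 : 0 < (2 * (rho + 1) * r i) `^ s by rewrite powR_gt0// !mulr_gt0.
rewrite lte_pdivrMr// => /ltW; rewrite -EFinM => /le_trans; apply.
rewrite lee_fin /zeta (powRM s (ltW _) (ltW ri0)) ?mulr_gt0//.
rewrite mulrA divfK ?gt_eqF// (powRM s (ltW h0) (ltW ri0)).
by rewrite mulrA.
Unshelve. all: by end_near. Qed.

End tangents.

Theorem proposition6p2 (R : realType) (d : nat) (E : set (euclidean R d))
  (s : R) (hs : 0 < s) (hE : finite_packing_content s E) :
  hausdorff_measure s
    [set x | E x /\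
       ~ (AppTan_AW E x s = Tan_AW E x /\
          forall Tx : set (euclidean R d),
            strong_approx_tangent E x s Tx -> Tan_AW E x = [set Tx])] = 0%E.
Proof.
apply/eqP; rewrite eq_le hausdorff_measure_ge0 andbT.
rewrite -(hausdorff_measure_starved hs hE); apply: le_hausdorff_measure.
move=> x [Ex bad]; apply: contrapT => notstarved; apply: bad.
have {}notstarved (n : nat) : ~ starved s E n%:R x.
  by move=> sx; apply: notstarved; exists n.
have AppTanE : AppTan_AW E x s = Tan_AW E x.
  apply/seteqP; split=> T [clT [r null_r lim]]; split=> //; exists r => //.
    exact: (approx_tangent_along_blowups hs notstarved Ex null_r lim).
  (* With [S i = E] the removed part is empty, so every tangent is an approximate tangent. *)
  exists (fun=> E); split=> [i|rho rho0|]; [by split | |exact: lim].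
  under eq_fun do rewrite setDE setIAC setICr set0I hausdorff_measure0// mul0e.
  exact: cvg_cst.
split=> // Tx [[clTx Tx0] strongTx]; apply/seteqP; split=> [T [[clT T0]]|T ->].
  move=> [r null_r limT].
  (* The strong tangent is a limit along every null sequence, in particular along the one producing
     [T], so uniqueness of limits applies. *)
  have limTx :=
    approx_tangent_along_blowups hs notstarved Ex null_r (strongTx _ null_r).
  apply/seteqP; split.
    exact: AW_blowups_to_unique limT limTx.
  exact: AW_blowups_to_unique limTx limT.
rewrite -AppTanE; split=> //.
(* A concrete null sequence shows that [Tx] itself is an approximate tangent. *)
have null_inv : pos_null_seq (fun n => n.+1%:R^-1 : R).
  by split=> [i|]; [rewrite invr_gt0|exact: cvg_harmonic].
by exists (fun n => n.+1%:R^-1) => //; exact: strongTx.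
Qed.
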